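(* Let $(\Omega,\mu)$ be a measure space, where $\mu$ is a $\sigma$-finite positive measure, and let $\mathbb{F}:\Omega\to H_1$ be a weakly measurable mapping. Then $\mathbb{F}$ is a continuous frame associated to $(a_2,\dots,a_n)$ with respect to $(\Omega,\mu)$ if and only if the pre-frame operator $T_C:L^2(\Omega,\mu)\to H_F$ of $\mathbb{F}$ is a (well-defined) bounded and onto operator.
   Context: Let $n\ge 2$. An $n$-inner product on a complex vector space $H$ with $\dim H\ge n$ is a map $(x,y,x_2,\dots,x_n)\mapsto\langle x,y\mid x_2,\dots,x_n\rangle\in\mathbb{C}$ such that: (i) $\langle x_1,x_1\mid x_2,\dots,x_n\rangle\ge 0$, with equality iff $x_1,\dots,x_n$ are linearly dependent; (ii) it is invariant under permutations of $x_2,\dots,x_n$; (iii) $\langle x,y\mid x_2,\dots,x_n\rangle=\overline{\langle y,x\mid x_2,\dots,x_n\rangle}$; (iv), (v) it is linear in $x$. The induced $n$-norm is $\|x_1,x_2,\dots,x_n\|=\langle x_1,x_1\mid x_2,\dots,x_n\rangle^{1/2}$. $H$ is an $n$-Hilbert space if it is complete: every sequence $(x_k)$ with $\|x_l-x_k,e_2,\dots,e_n\|\to0$ for all $e_2,\dots,e_n\in H$ has some $x\in H$ with $\|x_k-x,e_2,\dots,e_n\|\to 0$ for all $e_2,\dots,e_n\in H$. $H_1$ is a complex $n$-Hilbert space and $a_2,\dots,a_n\in H_1$ are fixed linearly independent elements. Let $L_F=\operatorname{span}\{a_2,\dots,a_n\}$ (the subscript $F$ refers to the set $\{a_2,\dots,a_n\}$).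 The form $\langle x+L_F,y+L_F\rangle_F=\langle x,y\mid a_2,\dots,a_n\rangle$ is an inner product on $H_1/L_F$; $H_F$ denotes its Hilbert space completion. Elements of $H_1$ are identified with their images in $H_F$, and $\langle\cdot,\cdot\mid a_2,\dots,a_n\rangle$ and $\|\cdot,a_2,\dots,a_n\|$ also denote the inner product and norm of $H_F$. A mapping $\mathbb{F}:\Omega\to H_1$ is weakly measurable if for every $f\in H_1$ the function $w\mapsto\langle f,\mathbb{F}(w)\mid a_2,\dots,a_n\rangle$ is measurable. It is a continuous frame associated to $(a_2,\dots,a_n)$ with respect to $(\Omega,\mu)$ if it is weakly measurable and there are constants $0<A\le B<\infty$ with $$A\|f,a_2,\dots,a_n\|^2\le\int_\Omega|\langle f,\mathbb{F}(w)\mid a_2,\dots,a_n\rangle|^2d\mu(w)\le B\|f,a_2,\dots,a_n\|^2\quad\text{for all } f\in H_1.$$ $L^2(\Omega,\mu)$ is the space of complex-valued square-integrable functions on $\Omega$. The pre-frame (synthesis) operator $T_C:L^2(\Omega,\mu)\to H_F$ of $\mathbb{F}$ is defined by $$\langle T_C(\varphi),f\mid a_2,\dots,a_n\rangle=\int_\Omega \varphi(w)\,\langle \mathbb{F}(w),f\mid a_2,\dots,a_n\rangle\,d\mu(w),\qquad \varphi\in L^2(\Omega,\mu),\ f\in H_F.$$ *)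

(* Defs.v *)
From HB Require Import structures.
From mathcomp Require Import all_boot all_order all_algebra.
From mathcomp Require Import complex ring lra.
From mathcomp Require Import all_classical all_reals all_analysis measurable_realfun.

Set Implicit Arguments.
Unset Strict Implicit.
Unset Printing Implicit Defensive.

Import Order.TTheory GRing.Theory Num.Theory.
Import numFieldNormedType.Exports.
Import ComplexField.Normc.

Local Open Scope classical_set_scope.
Local Open Scope ring_scope.
Local Open Scope complex_scope.
Local Open Scope quotient_scope.

(* The library only provides the additive group of V / S.                     *)
Section quotient_lmodule.
Context (K : nzRingType) (V : lmodType K) (S : {pred V}).
Hypothesis S_submod : submod_closed S.

Let S_zmod := GRing.isZmodClosed.Build V S (GRing.submod_closedB S_submod).
#[local] HB.instance Definition _ := S_zmod.
Definition submod_zmodClosed : zmodClosed V := S.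

Definition quot_lmod := Quotient.quot submod_zmodClosed.
HB.instance Definition _ := GRing.Zmodule.on quot_lmod.

Definition qproj (x : V) : quot_lmod := \pi_(Quotient.quot submod_zmodClosed) x.
Definition qrepr (u : quot_lmod) : V := repr (u : Quotient.quot submod_zmodClosed).

Lemma qreprK u : qproj (qrepr u) = u.
Proof. exact: reprK. Qed.

Lemma qproj_eq x y : (qproj x = qproj y) <-> (x - y \in S).
Proof.
have -> : (x - y \in S) = (qproj x == qproj y).
  by rewrite -(Quotient.idealrBE submod_zmodClosed).
by split=> /eqP.
Qed.

Lemma qreprB x : qrepr (qproj x) - x \in S.
Proof. by apply/qproj_eq; rewrite qreprK. Qed.

Definition quot_scale (c : K) (u : quot_lmod) : quot_lmod :=
  qproj (c *: qrepr u).

Lemma qproj_scale c x : quot_scale c (qproj x) = qproj (c *: x).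
Proof.
apply/qproj_eq; rewrite -scalerBr.
have [S0 Slin] := S_submod.
by rewrite -[_ *: _]addr0 Slin// qreprB.
Qed.

Lemma qproj_add x y : qproj (x + y) = qproj x + qproj y.
Proof. exact: (raddfD (\pi_(Quotient.quot submod_zmodClosed))). Qed.

Fact quot_scalerA c d u : quot_scale c (quot_scale d u) = quot_scale (c * d) u.
Proof. by rewrite -[u]qreprK !qproj_scale scalerA. Qed.

Fact quot_scale1r u : quot_scale 1 u = u.
Proof. by rewrite -[u]qreprK !qproj_scale scale1r. Qed.

Fact quot_scalerDr c u v : quot_scale c (u + v) = quot_scale c u + quot_scale c v.
Proof.
by rewrite -[u]qreprK -[v]qreprK -qproj_add !qproj_scale scalerDr qproj_add.
Qed.

Fact quot_scalerDl u c d : quot_scale (c + d) u = quot_scale c u + quot_scale d u.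
Proof. by rewrite -[u]qreprK !qproj_scale scalerDl qproj_add. Qed.

HB.instance Definition _ := GRing.Zmodule_isLmodule.Build K quot_lmod
  quot_scalerA quot_scale1r quot_scalerDr quot_scalerDl.

Fact qproj_linear : linear qproj.
Proof. by move=> c x y; rewrite qproj_add -qproj_scale. Qed.

HB.instance Definition _ := GRing.isLinear.Build K V quot_lmod *:%R qproj qproj_linear.

End quotient_lmodule.

Section complex_integration.
Context (R : realType) d (T : measurableType d) (mu : {measure set T -> \bar R}).
Implicit Types f g : T -> R[i].

Definition cmeasurable_fun f :=
  measurable_fun [set: T] (fun w => complex.Re (f w)) /\
  measurable_fun [set: T] (fun w => complex.Im (f w)).

Definition cintegrable f :=
  mu.-integrable [set: T] (fun w => (complex.Re (f w))%:E) /\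
  mu.-integrable [set: T] (fun w => (complex.Im (f w))%:E).

Definition cintegral f : R[i] :=
  (\int[mu]_w complex.Re (f w)) +i* (\int[mu]_w complex.Im (f w)).

Definition square_integrable f :=
  cmeasurable_fun f /\ (\int[mu]_w ((normc (f w) ^+ 2)%:E) < +oo)%E.

Definition L2pred : {pred T -> R[i]} := fun f => `[< square_integrable f >].

Lemma sqr_normc (z : R[i]) : normc z ^+ 2 = complex.Re z ^+ 2 + complex.Im z ^+ 2.
Proof. by case: z => x y /=; rewrite sqr_sqrtr// addr_ge0// sqr_ge0. Qed.

Lemma measurable_sqr_normc f : cmeasurable_fun f ->
  measurable_fun [set: T] (fun w => normc (f w) ^+ 2).
Proof.
move=> [mr mi]; rewrite (_ : (fun _ => _) =
  (fun w => complex.Re (f w) ^+ 2 + complex.Im (f w) ^+ 2)).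
  by apply: measurable_funD; exact: measurable_funX.
by apply/funext => w; rewrite sqr_normc.
Qed.

Lemma cmeasurable_funZD c f g :
  cmeasurable_fun f -> cmeasurable_fun g -> cmeasurable_fun (c *: f + g).
Proof.
case: c => x y [fr fi] [gr gi]; split.
- rewrite (_ : (fun _ => _) = (fun w =>
    (x * complex.Re (f w) - y * complex.Im (f w)) + complex.Re (g w))).
    apply: measurable_funD => //.
    by apply: measurable_funB; exact: measurable_funM.
  apply/funext => w; rewrite -[(_ + g) w]/((x +i* y) * f w + g w).
  by case: (f w) => ? ?; case: (g w).
- rewrite (_ : (fun _ => _) = (fun w =>
    (x * complex.Im (f w) + y * complex.Re (f w)) + complex.Im (g w))).
    apply: measurable_funD => //.
    by apply: measurable_funD; exact: measurable_funM.
  apply/funext => w; rewrite -[(_ + g) w]/((x +i* y) * f w + g w).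
  by case: (f w) => ? ?; case: (g w).
Qed.

Fact L2pred_submod_closed : submod_closed L2pred.
Proof.
split.
  apply/asboolP; split; first by split; exact: measurable_cst.
  rewrite integral0_eq// => w _ /=.
  by rewrite expr0n /= addr0 sqrtr0 expr0n.
move=> c f g /asboolP[mf f2] /asboolP[mg g2]; apply/asboolP.
have mfg := cmeasurable_funZD c mf mg.
split=> //.
have m2 h : cmeasurable_fun h ->
    measurable_fun [set: T] (fun w => (normc (h w) ^+ 2)%:E).
  by move=> mh; apply/measurable_EFinP; exact: measurable_sqr_normc.
pose b := 2 * normc c ^+ 2.
have b0 : 0 <= b by rewrite mulr_ge0// sqr_ge0.
apply: (@le_lt_trans _ _ (\int[mu]_w
    (b%:E * (normc (f w) ^+ 2)%:E + 2%:E * (normc (g w) ^+ 2)%:E))%E).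
  apply: ge0_le_integral => //=.
  - by move=> w _; rewrite lee_fin sqr_ge0.
  - exact: m2.
  - by apply: emeasurable_funD; apply: emeasurable_funM => //; exact: m2.
  move=> w _; rewrite -!EFinM -EFinD lee_fin /b !sqr_normc.
  rewrite -[(c *: f + g) w]/(c * f w + g w).
  case: c {b b0 mfg} => x y; case: (f w) => u v; case: (g w) => p q /=.
  have := sqr_ge0 (x * u - y * v - p); have := sqr_ge0 (x * v + y * u - q).
  rewrite -subr_ge0; nra.
rewrite ge0_integralD//; last 4 first.
- by move=> w _; rewrite mule_ge0// lee_fin// sqr_ge0.
- by apply: emeasurable_funM => //; exact: m2.
- by move=> w _; rewrite mule_ge0// lee_fin// sqr_ge0.
- by apply: emeasurable_funM => //; exact: m2.
rewrite !ge0_integralZl//; try exact: m2; try by move=> w _; rewrite lee_fin sqr_ge0.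
by rewrite lte_add_pinfty// lte_mul_pinfty// lee_fin.
Qed.

HB.instance Definition _ := GRing.isSubmodClosed.Build R[i] (T -> R[i]) L2pred
  L2pred_submod_closed.

Record L2fun := MkL2fun { L2val :> T -> R[i]; _ : L2val \in L2pred }.

HB.instance Definition _ := [isSub for L2val].
HB.instance Definition _ := [Choice of L2fun by <:].
HB.instance Definition _ := [SubChoice_isSubLmodule of L2fun by <:].

Definition ae_null : {pred L2fun} := fun u => `[< \forall w \ae mu, u w = 0 >].

Fact ae_null_submod_closed : submod_closed ae_null.
Proof.
split; first by apply/asboolP; apply/aeW.
move=> c u v /asboolP u0 /asboolP v0; apply/asboolP.
move: u0 v0; apply: filterS2 => w /= u0 v0.
by rewrite -[LHS]/(c * u w + v w) u0 v0 mulr0 addr0.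
Qed.

Definition L2 := quot_lmod ae_null_submod_closed.
HB.instance Definition _ := GRing.Lmodule.on L2.

Definition L2class (u : L2fun) : L2 := qproj ae_null_submod_closed u.

Definition L2norm (u : L2) : R :=
  Num.sqrt (fine (\int[mu]_w ((normc (qrepr u w) ^+ 2)%:E))).

Lemma L2normE (u : L2fun) :
  L2norm (L2class u) = Num.sqrt (fine (\int[mu]_w ((normc (u w) ^+ 2)%:E))).
Proof.
rewrite /L2norm; congr (Num.sqrt (fine _)).
have m2 (v : L2fun) : measurable_fun [set: T] (fun w => (normc (v w) ^+ 2)%:E).
  apply/measurable_EFinP; apply: measurable_sqr_normc.
  by case: v => v /= /asboolP[].
apply: ge0_ae_eq_integral => //; try by move=> w _; rewrite lee_fin sqr_ge0.
have /asboolP := qreprB ae_null_submod_closed u.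
apply: filterS => w /eqP + _.
by rewrite -[X in X == 0]/(qrepr (L2class u) w - u w) subr_eq0 => /eqP ->.
Qed.

End complex_integration.

Section n_inner_product.
Context (R : realType) (n : nat) (H : lmodType R[i]).
Implicit Types (x y : H) (s t : n.-1.-tuple H).

Definition lin_indep (r : seq H) :=
  forall c : 'I_(size r) -> R[i],
    \sum_(i < size r) c i *: r`_i = 0 -> forall i, c i = 0.

(* [ip x y s] is <x, y | s_1, ..., s_(n-1)> *)
Record n_inner_product (ip : H -> H -> n.-1.-tuple H -> R[i]) : Prop := {
  nip_dim : exists v : n.-tuple H, lin_indep v;
  nip_ge0 : forall x s, 0 <= ip x x s;
  nip_eq0 : forall x s, ip x x s = 0 <-> ~ lin_indep (x :: s);
  nip_perm : forall x y s t, perm_eq s t -> ip x y s = ip x y t;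
  nip_conj : forall x y s, ip x y s = (ip y x s)^*%R;
  nip_add : forall x x' y s, ip (x + x') y s = ip x y s + ip x' y s;
  nip_scale : forall c x y s, ip (c *: x) y s = c * ip x y s }.

Definition nnorm (ip : H -> H -> n.-1.-tuple H -> R[i]) x s : R :=
  Num.sqrt (complex.Re (ip x x s)).

Definition n_complete (ip : H -> H -> n.-1.-tuple H -> R[i]) :=
  forall u : nat -> H,
    (forall s, nnorm ip (u p.1 - u p.2) s @[p --> (\oo, \oo)] --> (0 : R)) ->
    exists x, forall s, nnorm ip (u k - x) s @[k --> \oo] --> (0 : R).

Definition n_hilbert (ip : H -> H -> n.-1.-tuple H -> R[i]) :=
  n_inner_product ip /\ n_complete ip.

End n_inner_product.

Lemma ge0_affine_eq0 (C : numClosedFieldType) (b B : C) : 0 <= B ->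
  (forall c : C, 0 <= B + (c * b + Num.conj c * Num.conj b)) -> b = 0.
Proof.
move=> B0 ge0; apply/eqP/negPn/negP => b0.
have b2 : `|b| ^+ 2 != 0 by rewrite expf_eq0/= normr_eq0.
pose k := (B + 1) / `|b| ^+ 2.
have kr : Num.conj k = k.
  by apply/CrealP; rewrite ger0_real// divr_ge0 ?exprn_ge0// addr_ge0.
have := ge0 (- k * Num.conj b).
rewrite rmorphM rmorphN /= kr conjCK -!mulrA [Num.conj b * b]mulrC -normCK.
rewrite !mulNr divfK// (_ : B + _ = - (B + 2)); last by ring.
by rewrite oppr_ge0 => /(lt_le_trans (ltr_wpDl B0 (ltr0n C 2))); rewrite ltxx.
Qed.

Section quotient_inner_product.
Context (R : realType) (n : nat) (H : lmodType R[i]).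
Variables (ip : H -> H -> n.-1.-tuple H -> R[i]) (a : n.-1.-tuple H).

Definition LF : {pred H} := fun x =>
  `[< exists c : 'I_n.-1 -> R[i], x = \sum_i c i *: tnth a i >].

Fact LF_submod_closed : submod_closed LF.
Proof.
split; first by apply/asboolP; exists (fun=> 0); rewrite big1// => i _; rewrite scale0r.
move=> c x y /asboolP[b ->] /asboolP[b' ->]; apply/asboolP.
exists (fun i => c * b i + b' i).
rewrite scaler_sumr -big_split/=; apply: eq_bigr => i _.
by rewrite scalerDl scalerA.
Qed.

Definition quotF := quot_lmod LF_submod_closed.
HB.instance Definition _ := GRing.Lmodule.on quotF.

Definition ipF (u v : quotF) : R[i] := ip (qrepr u) (qrepr v) a.

Lemma LF_dep x : x \in LF -> ~ lin_indep (x :: a).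
Proof.
move=> /asboolP[c xc].
pose e (k : nat) := if insub k is Some i then c i else 0.
pose e' (k : nat) := if k is k'.+1 then - e k' else 1.
move=> /(_ (fun i => e' i)) indep.
suff /indep /(_ ord0)/eqP : \sum_(i < size (x :: a)) e' i *: (x :: a)`_i = 0.
  by rewrite oner_eq0.
rewrite /= big_ord_recl/= scale1r size_tuple; apply/eqP.
rewrite addr_eq0 xc -sumrN; apply/eqP; apply: eq_bigr => i _.
by rewrite -[(0 + i)%N]/(val i) scaleNr opprK /e valK (tnth_nth 0).
Qed.

Hypothesis ip_n : n_inner_product ip.

Lemma ip_LFl x y : x \in LF -> ip x y a = 0.
Proof.
case: (ip_n) => _ ge0 eq0 _ ipC ipD ipZ xF.
have ipDr u v w : ip u (v + w) a = ip u v a + ip u w a.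
  by rewrite [LHS]ipC ipD rmorphD (ipC u v) (ipC u w).
have ipZr c u v : ip u (c *: v) a = Num.conj c * ip u v a.
  by rewrite [LHS]ipC ipZ rmorphM (ipC u v).
have x0 : ip x x a = 0 by apply/eq0; exact: LF_dep.
apply: (@ge0_affine_eq0 _ _ (ip y y a)) => // c.
have := ge0 (y + c *: x) a.
by rewrite ipD !ipDr !ipZ !ipZr x0 (ipC y x) !mulr0 addr0 -addrA [_ + c * _]addrC.
Qed.

(* The form does not depend on the representatives *)
Lemma ipFE x y :
  ipF (qproj LF_submod_closed x) (qproj LF_submod_closed y) = ip x y a.
Proof.
have /ip_LFl xF := qreprB LF_submod_closed x.
have /ip_LFl yF := qreprB LF_submod_closed y.
case: (ip_n) => _ _ _ _ ipC ipD _.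
rewrite /ipF; move: xF yF.
set x' := qrepr _; set y' := qrepr _ => xF yF.
rewrite -(subrK x x') ipD xF add0r ipC -(subrK y y') ipD yF add0r.
by rewrite -ipC.
Qed.

End quotient_inner_product.

Section hilbert_completion.
Context (R : realType) (n : nat) (H : lmodType R[i]).
Variables (ip : H -> H -> n.-1.-tuple H -> R[i]) (a : n.-1.-tuple H).
Variables (HF : completeNormedModType R[i]).
Variables (dotF : {dot HF for Num.conj}) (j : {linear quotF a -> HF}).

Record hilbert_completion : Prop := {
  hc_norm : forall h, `|h| ^+ 2 = dotF h h;
  hc_isom : forall u v, dotF (j u) (j v) = ipF ip u v;
  hc_dense : dense (range j) }.

Definition embF (x : H) : HF := j (qproj (LF_submod_closed a) x).

End hilbert_completion.

Section frames.
Context (R : realType) (n : nat) (H : lmodType R[i]).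
Variables (ip : H -> H -> n.-1.-tuple H -> R[i]) (a : n.-1.-tuple H).
Context d (Om : measurableType d) (mu : {measure set Om -> \bar R}).
Variable F : Om -> H.

Definition weakly_measurable :=
  forall f : H, cmeasurable_fun (fun w => ip f (F w) a).

Definition continuous_frame :=
  weakly_measurable /\
  exists A B : R, [/\ 0 < A, A <= B & forall f : H,
    ((A * nnorm ip f a ^+ 2)%:E
       <= \int[mu]_w (normc (ip f (F w) a) ^+ 2)%:E
       <= (B * nnorm ip f a ^+ 2)%:E)%E].

Variables (HF : completeNormedModType R[i]) (dotF : {dot HF for Num.conj}).
Variable j : {linear quotF a -> HF}.

(* Integrability is part of the definition: [cintegral] is a total function.  *)
Definition preframe_operator (TC : L2 mu -> HF) :=
  forall (phi : L2fun mu) (f : HF),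
    cintegrable mu (fun w => phi w * dotF (embF j (F w)) f) /\
    dotF (TC (L2class phi)) f =
      cintegral mu (fun w => phi w * dotF (embF j (F w)) f).

Definition bounded_operator (TC : L2 mu -> HF) :=
  exists M : R, forall u : L2 mu, `|TC u| <= (M * L2norm u)%:C.

End frames.

(* Main.v *)
Require Import Defs.
From HB Require Import structures.
From mathcomp Require Import all_boot all_order all_algebra.
From mathcomp Require Import complex ring lra.
From mathcomp Require Import all_classical all_reals all_analysis measurable_realfun.

(** Let S : HF -> L^2 be the analysis operator, S f (w) = <f, F(w)>, whose
    adjoint is the synthesis operator TC.  The frame inequality
    A |f|^2 <= |S f|^2 <= B |f|^2 says that S is bounded and bounded below,
    and the theorem is the duality between this and TC being bounded and onto.

    From the frame to TC.  The frame inequality is only given on the image of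
    H1, which is dense in HF, and first extends to all of HF with worse
    constants: Fatou's lemma gives the upper bound and the measurability of
    S f ([analysis_bound]), and a perturbation argument the lower bound
    ([analysis_coercive]).  Both the existence of TC and its surjectivity are
    then instances of one representation theorem, [lax_milgram]: a functional
    that is bounded with respect to a symmetric, bounded and coercive form is
    represented by a vector.  With the inner product of HF as the form it
    represents f |-> <phi, S f> and defines TC phi ([synthesis_exists]).  With
    the form <S f, S g>, coercive by the lower frame bound, it gives for each h
    an x with <S x, S g> = <h, g> for all g, that is, TC (S x) = h
    ([synthesis_onto]).

    From TC to the frame.  It is not known beforehand that S f is square
    integrable, so TC is applied to the truncations S f 1_E, where the sets E
    exhaust the space and S f 1_E is square integrable; this is where
    sigma-finiteness enters.  Since <TC (S f 1_E), f> is the squared norm of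
    S f 1_E, boundedness of TC bounds the latter by M^2 |f|^2, uniformly in E
    ([bounded_synthesis_bessel]).  If there were no lower bound, there would be
    vectors g_k with |g_k| = 4^k and |S g_k| < 1; then <TC u, g_k> = <u, S g_k>
    is bounded in k for each u, whereas [gliding_hump] produces an h for which
    <h, g_k> is unbounded, so that h is not in the range of TC
    ([onto_synthesis_coercive]).

    All inner products are replaced by their real parts, which determine them
    because Im <x, y> = Re <x, i y>.  Cauchy-Schwarz in L^2 is replaced by
    Young's inequality 2 <phi, psi> <= t |phi|^2 + |psi|^2 / t. *)

Set Implicit Arguments.
Unset Strict Implicit.
Unset Printing Implicit Defensive.

Import Order.TTheory GRing.Theory Num.Theory.
Import numFieldNormedType.Exports.
Import ComplexField.Normc.

Local Open Scope classical_set_scope.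
Local Open Scope ring_scope.
Local Open Scope complex_scope.

(** * Complete normed spaces and representation of functionals *)

Section real_norm.
Context (R : realType) (V : completeNormedModType R[i]).
Implicit Types (x y : V) (c : R) (u : nat -> V).

(** The norm of a space over [R[i]] takes values in [R[i]]; [rnorm] is the same
    norm with values in the ordered field [R], in which all estimates are made. *)
Definition rnorm x : R := complex.Re `|x|.

Lemma rnormE x : `|x| = (rnorm x)%:C.
Proof.
rewrite /rnorm; have := normr_ge0 x.
by case: `|x| => p q; rewrite lecE /= => /andP[/eqP -> _].
Qed.

Lemma rnorm_ge0 x : 0 <= rnorm x.
Proof. by rewrite -lecR -rnormE normr_ge0. Qed.

Lemma rnorm_gt0 x : (0 < rnorm x) = (x != 0).
Proof. by rewrite -ltcR -rnormE normr_gt0. Qed.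

Lemma rnorm_triangle x y : rnorm (x + y) <= rnorm x + rnorm y.
Proof. by rewrite -lecR rmorphD /= -!rnormE ler_normD. Qed.

Lemma rnormN x : rnorm (- x) = rnorm x.
Proof. by rewrite /rnorm normrN. Qed.

Lemma rnormZ c x : rnorm (c%:C *: x) = `|c| * rnorm x.
Proof.
apply: (@complexI R); rewrite rmorphM /= -!rnormE normrZ; congr (_ * _).
by rewrite normc_def /= expr0n /= addr0 sqrtr_sqr.
Qed.

Lemma complex_gt0E (e : R[i]) : 0 < e -> e = (complex.Re e)%:C /\ 0 < complex.Re e.
Proof. by case: e => p q; rewrite ltcE /= => /andP[/eqP -> ?]. Qed.

Lemma rnorm_complete u :
  (forall e, 0 < e -> exists N, forall k l, (N <= k)%N -> (N <= l)%N ->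
     rnorm (u k - u l) < e) ->
  exists x, forall e, 0 < e -> exists N, forall k, (N <= k)%N ->
    rnorm (x - u k) < e.
Proof.
move=> u_cauchy.
have : cauchy_ex (u k @[k --> \oo]).
  move=> e /complex_gt0E [-> /u_cauchy[N uN]]; exists (u N), N => // k /= Nk.
  by rewrite -ball_normE /= rnormE ltcR uN.
move=> /cauchy_exP /cauchy_cvg /cvg_ex [x ux]; exists x => e e0.
have e0' : 0 < e%:C :> R[i] by rewrite ltcR.
have /(_ _ (nbhsx_ballx x _ e0')) [N _ xN] := ux.
exists N => k /xN.
by rewrite /= -ball_normE /= rnormE ltcR.
Qed.

Lemma rnorm_dense (D : set V) : dense D -> forall x e, 0 < e ->
  exists2 y, D y & rnorm (x - y) < e.
Proof.
move=> dD x e e0; have e0' : 0 < e%:C :> R[i] by rewrite ltcR.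
have [||y [xy Dy]] := dD (ball x e%:C).
- by exists x; exact: ballxx.
- exact: ball_open.
by exists y => //; move: xy; rewrite -ball_normE /= rnormE ltcR.
Qed.

Section lax_milgram.
Variables (b : V -> V -> R) (A B : R) (L : V -> R) (C : R).
Hypotheses (bC : forall x y, b x y = b y x)
  (bD : forall x y z, b (x + y) z = b x z + b y z)
  (bZ : forall c x y, b (c%:C *: x) y = c * b x y)
  (A_gt0 : 0 < A) (b_coercive : forall x, A * rnorm x ^+ 2 <= b x x)
  (b_bounded : forall x, b x x <= B * rnorm x ^+ 2)
  (LD : forall x y, L (x + y) = L x + L y)
  (LZ : forall c x, L (c%:C *: x) = c * L x)
  (L_bounded : forall x, 2 * L x <= b x x + C).

Let bDr x y z : b x (y + z) = b x y + b x z.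
Proof. by rewrite bC bD !(bC x). Qed.
Let bZr c x y : b x (c%:C *: y) = c * b x y.
Proof. by rewrite bC bZ bC. Qed.
Let b_ge0 x : 0 <= b x x.
Proof. by apply: le_trans (b_coercive x); rewrite mulr_ge0 ?sqr_ge0// ltW. Qed.
Let scN x : - x = (-1)%:C *: x.
Proof. by rewrite rmorphN1 scaleN1r. Qed.

(** The direct method: the quadratic functional J x = b x x - 2 L x is bounded
    below, and by the parallelogram law b (x - y) (x - y) is at most
    2 (J x - m) + 2 (J y - m), m the infimum of J.  A minimizing sequence is thus
    Cauchy by coercivity, and the first variation of J vanishes at its limit.
    Boundedness of L is stated relative to b, as [L_bounded], which is what
    Young's inequality provides in the applications. *)
Lemma lax_milgram : exists x, forall g, b x g = L g.
Proof.
pose J x := b x x - 2 * L x.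
have J_lb : lbound (range J) (- C).
  by move=> _ [x _ <-]; have := L_bounded x; rewrite /J; lra.
have hJ : has_inf (range J) by split; [exists (J 0), 0 | exists (- C)].
pose m := inf (range J).
have Jm x : m <= J x by apply: ge_inf; [exists (- C) | exists x].
have [u Ju] : {u : nat -> V & forall k, J (u k) < m + k.+1%:R^-1}.
  apply: (@choice _ _ (fun k x => J x < m + k.+1%:R^-1)) => k.
  have [|_ [x _ <-] ?] := @inf_adherent _ (range J) k.+1%:R^-1 _ hJ.
    by rewrite invr_gt0.
  by exists x.
have u_cauchy k l : b (u k - u l) (u k - u l) <= 2 * (k.+1%:R^-1 + l.+1%:R^-1).
  have /= := Jm ((2^-1)%:C *: (u k + u l)); have := Ju k; have := Ju l.
  move: (k.+1%:R^-1) (l.+1%:R^-1) => p q.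
  rewrite /J scN !(bD, bDr, bZ, bZr, LD, LZ) (bC (u l) (u k)); lra.
have small e : 0 < e -> exists N, forall k, (N <= k)%N -> k.+1%:R^-1 < e :> R.
  move=> e0; exists (Num.truncn e^-1) => k Nk.
  rewrite invf_plt ?posrE// (lt_le_trans (truncnS_gt _))//.
  by rewrite ler_nat ltnS.
have [x ux] : exists x, forall e, 0 < e -> exists N, forall k, (N <= k)%N ->
    rnorm (x - u k) < e.
  apply: rnorm_complete => e e0.
  have [|N HN] := small (A * e ^+ 2 / 4); first by rewrite divr_gt0// mulr_gt0 ?exprn_gt0.
  exists N => k l /HN Nk /HN Nl.
  rewrite -(ltr_pXn2r (isT : (0 < 2)%N)) ?nnegrE ?rnorm_ge0 ?(ltW e0)//.
  rewrite -(ltr_pM2l A_gt0).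
  have := b_coercive (u k - u l); have := u_cauchy k l.
  by move: (k.+1%:R^-1) (l.+1%:R^-1) Nk Nl => p q; lra.
exists x => g; apply/eqP; rewrite -subr_eq0; apply/eqP; set D := b x g - L g.
(* The first variation, without continuity of J: expand J (u k + t g) >= m and
   absorb the error b (x - u k) (t g) by the positivity of b at
   x - u k + t g; this costs a second t^2 * b g g, harmless as t -> 0. *)
have step t : 0 <= t * D + t ^+ 2 * b g g.
  rewrite -(pmulr_rge0 _ (ltr0n R 2)) leNgt; apply/negP => neg.
  set r := 2 * _ in neg.
  have r0 : 0 < - r / 2 by rewrite divr_gt0 ?oppr_gt0.
  have [N1 HN1] := small _ r0.
  have B0 : 0 < `|B| + 1 by rewrite ltr_wpDl.
  have [|N2 HN2] := ux (Num.sqrt (- r / 2 / (`|B| + 1))).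
    by rewrite sqrtr_gt0 divr_gt0.
  pose k := maxn N1 N2.
  have {HN1} e1 := HN1 k (leq_maxl _ _); have {HN2} e2 := HN2 k (leq_maxr _ _).
  have {e2} : b (x - u k) (x - u k) < - r / 2.
    apply: (le_lt_trans (b_bounded _)).
    apply: (@le_lt_trans _ _ ((`|B| + 1) * rnorm (x - u k) ^+ 2)).
      by rewrite ler_wpM2r ?sqr_ge0// (le_trans (ler_norm B))// lerDl.
    rewrite mulrC -ltr_pdivlMr// -(sqr_sqrtr (_ : 0 <= - r / 2 / _)).
      by rewrite ltr_pXn2r ?nnegrE ?rnorm_ge0 ?sqrtr_ge0.
    by rewrite divr_ge0// ltW.
  have := Ju k; have := Jm (u k + t%:C *: g); move: (k.+1%:R^-1) e1 => p e1.
  have := b_ge0 (x - u k + t%:C *: g).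
  rewrite /J /r /D in e1 neg *.
  rewrite !scN !(bD, bDr, bZ, bZr, LD, LZ) (bC g (u k)) (bC g x) (bC (u k) x).
  lra.
have s0 : 0 < b g g + 1 by rewrite ltr_wpDl.
(* With t = - D / (b g g + 1), the bound [step] reads - t^2 >= 0. *)
have := step (- D / (b g g + 1)).
rewrite (_ : _ + _ = - (D / (b g g + 1)) ^+ 2); last by field; rewrite gt_eqF.
rewrite oppr_ge0 => D0; have /eqP : (D / (b g g + 1)) ^+ 2 = 0.
  by apply/eqP; rewrite eq_le D0 sqr_ge0.
by rewrite sqrf_eq0 mulf_eq0 invr_eq0 (gt_eqF s0) orbF => /eqP.
Qed.

End lax_milgram.

Lemma geometric_limit u : (forall k, rnorm (u k.+1 - u k) <= 3 ^- k) ->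
  exists x, forall k, rnorm (x - u k) <= 3 / 2 * 3 ^- k.
Proof.
move=> hu.
have p3 k : 0 < 3 ^- k :> R by rewrite invr_gt0 exprn_gt0.
have tail k l : rnorm (u (k + l)%N - u k) <= 3 / 2 * (3 ^- k - 3 ^- (k + l)%N).
  elim: l => [|l IHl].
    by rewrite addn0 !subrr mulr0 /rnorm normr0.
  rewrite addnS -(subrK (u (k + l)%N) (u _)) -addrA.
  apply: (le_trans (rnorm_triangle _ _)); have := hu (k + l)%N.
  by rewrite [3 ^+ _.+1]exprS invfM; lra.
have tail' k l : rnorm (u (k + l)%N - u k) <= 3 / 2 * 3 ^- k.
  by apply: (le_trans (tail k l)); have := p3 (k + l)%N; lra.
have small e : 0 < e -> exists k, 3 ^- k < e :> R.
  move=> e0; exists (Num.truncn e^-1).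
  rewrite invf_plt ?posrE ?exprn_gt0// (lt_le_trans (truncnS_gt _))//.
  by rewrite -natrX ler_nat ltn_expl.
have [x ux] : exists x, forall e, 0 < e -> exists N, forall k, (N <= k)%N ->
    rnorm (x - u k) < e.
  apply: rnorm_complete => e e0.
  have [|N HN] := small (e / 4); first by rewrite divr_gt0.
  exists N => k l /subnKC <- /subnKC <-.
  rewrite -(subrK (u N) (u (N + (k - N))%N)) -addrA.
  apply: (le_lt_trans (rnorm_triangle _ _)).
  rewrite -(rnormN (u N - _)) opprB.
  have := tail' N (k - N)%N; have := tail' N (l - N)%N; lra.
exists x => k; apply/ler_addgt0Pr => e e0.
have [N HN] := ux _ e0.
rewrite -(subrK (u (k + N)%N) x) -addrA (le_trans (rnorm_triangle _ _))//.
rewrite [leRHS]addrC lerD//; first by rewrite ltW// HN// leq_addl.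
Qed.

End real_norm.

(** * Hilbert spaces through the real part of the inner product *)

Section real_dot.
Context (R : realType) (V : completeNormedModType R[i]).
Variable dot : {dot V for Num.conj}.
Hypothesis dot_norm : forall h, `|h| ^+ 2 = dot h h.
Implicit Types (x y z : V) (c : R[i]) (r : R).

Lemma dotC x y : dot x y = Num.conj (dot y x).
Proof. by rewrite hermC expr0 mul1r. Qed.

Lemma dotZl c x y : dot (c *: x) y = c * dot x y.
Proof. exact: linearZl_LR. Qed.

Lemma dotZr c x y : dot x (c *: y) = Num.conj c * dot x y.
Proof. exact: linearZr_LR. Qed.

Lemma dotDl x y z : dot (x + y) z = dot x z + dot y z.
Proof. exact: linearDl. Qed.

Definition rdot x y : R := complex.Re (dot x y).

Lemma rdotC x y : rdot x y = rdot y x.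
Proof. by rewrite /rdot dotC; case: (dot y x). Qed.

Lemma rdotDl x y z : rdot (x + y) z = rdot x z + rdot y z.
Proof. by rewrite /rdot dotDl raddfD. Qed.

Lemma rdotZl r x y : rdot (r%:C *: x) y = r * rdot x y.
Proof. by rewrite /rdot dotZl; case: (dot x y) => p q /=; rewrite mul0r subr0. Qed.

Lemma rdotDr x y z : rdot x (y + z) = rdot x y + rdot x z.
Proof. by rewrite rdotC rdotDl !(rdotC x). Qed.

Lemma rdotZr r x y : rdot x (r%:C *: y) = r * rdot x y.
Proof. by rewrite rdotC rdotZl rdotC. Qed.

Lemma rdotNl x y : rdot (- x) y = - rdot x y.
Proof. by rewrite -scaleN1r -(rmorphN1 (real_complex R)) rdotZl mulN1r. Qed.

Lemma rdotNr x y : rdot x (- y) = - rdot x y.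
Proof. by rewrite rdotC rdotNl rdotC. Qed.

(** The adjoint of multiplication by [c], which carries complex linearity
    through the real parts. *)
Lemma rdotZ_adj c x y : rdot (c *: x) y = rdot x (Num.conj c *: y).
Proof. by rewrite /rdot dotZl dotZr conjCK. Qed.

(** The real part alone determines the inner product: multiplication by the
    imaginary unit in the second argument recovers the imaginary part. *)
Lemma Im_dot x y : complex.Im (dot x y) = rdot x ((0 +i* 1) *: y).
Proof. by rewrite /rdot dotZr; case: (dot x y) => p q /=; ring. Qed.

Lemma rdotxx x : rdot x x = rnorm x ^+ 2.
Proof.
by rewrite /rdot -dot_norm rnormE -rmorphXn /=.
Qed.

Lemma rdot_inj x y : (forall z, rdot x z = rdot y z) -> x = y.
Proof.
move=> xy; apply/eqP; rewrite -subr_eq0 -normr_eq0 rnormE.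
suff /eqP : rnorm (x - y) ^+ 2 = 0 by rewrite sqrf_eq0 => /eqP ->.
by rewrite -rdotxx rdotDl rdotNl xy subrr.
Qed.

Lemma rdot_le x y : rdot x y <= rnorm x * rnorm y.
Proof.
have [->|x0] := eqVneq x 0.
  by rewrite /rdot linear0l /= mulr_ge0 ?rnorm_ge0.
have [->|y0] := eqVneq y 0.
  by rewrite /rdot linear0r /= mulr_ge0 ?rnorm_ge0.
have p0 : 0 < rnorm x * rnorm y by rewrite mulr_gt0 ?rnorm_gt0.
rewrite -(ler_pM2l p0).
have := sqr_ge0 (rnorm ((rnorm y)%:C *: x - (rnorm x)%:C *: y)).
rewrite -rdotxx !(rdotDl, rdotDr, rdotNl, rdotNr, rdotZl, rdotZr) !rdotxx (rdotC y x).
nra.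
Qed.

Lemma ler_rdot x y : `|rdot x y| <= rnorm x * rnorm y.
Proof.
rewrite ler_norml rdot_le andbT -lerN2 opprK -rdotNl -(rnormN x); exact: rdot_le.
Qed.

(** A case of the uniform boundedness principle, by Sokal's argument: start
    from 0 and add at step k the vector 12^-k g_k of norm 3^-k, with the sign that
    makes the product with g_k at least (4/3)^k.  The later steps move the sum by at
    most 3^-k / 2, so at least half of this product remains in the limit. *)
Lemma gliding_hump (g : nat -> V) : (forall k, rnorm (g k) = 4 ^+ k) ->
  exists x, forall M, exists k, M < `|rdot x (g k)|.
Proof.
move=> g4.
pose s k x : R := if 0 <= rdot x (g k) then 12 ^- k else - 12 ^- k.
pose fix u k := if k is k'.+1 then u k' + (s k' (u k'))%:C *: g k' else 0.
have s12 k x : `|s k x| = 12 ^- k.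
  by rewrite /s; case: ifP; rewrite ?normrN gtr0_norm// invr_gt0 exprn_gt0.
have e12 k : 12 ^- k * 4 ^+ k = 3 ^- k :> R.
  by rewrite -!exprVn -exprMn; congr (_ ^+ k); field.
have [|x ux] := @geometric_limit _ V u.
  by move=> k; rewrite /= addrC addKr rnormZ s12 g4 e12.
have hump k : (4 / 3) ^+ k <= `|rdot (u k.+1) (g k)|.
  rewrite /= rdotDl rdotZl rdotxx g4.
  have -> : (4 / 3) ^+ k = 12 ^- k * (4 ^+ k) ^+ 2 :> R.
    by rewrite expr2 mulrA e12 exprMn exprVn mulrC.
  have : 0 <= 12 ^- k * (4 ^+ k) ^+ 2 :> R.
    by rewrite mulr_ge0 ?invr_ge0 ?exprn_ge0.
  rewrite /s; case: (lerP 0 (rdot (u k) (g k))) => h; rewrite ?mulNr;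
    move: (12 ^- k * _) h => p h p0.
  - by apply: le_trans (ler_norm _); rewrite lerDr.
  - by rewrite -normrN; apply: le_trans (ler_norm _); lra.
exists x => M.
(* Bernoulli's inequality for (1 + 1/3)^k. *)
have [k Mk] : exists k, M < (4 / 3) ^+ k / 2.
  exists (Num.truncn (`|M| * 6)); set k := Num.truncn _.
  have : 1 + k%:R / 3 <= (4 / 3) ^+ k :> R.
    elim: k => [|k IHk]; first by rewrite expr0 mul0r addr0.
    rewrite exprS -natr1.
    apply: (@le_trans _ _ (4 / 3 * (1 + k%:R / 3))); last by rewrite ler_pM2l.
    by have := ler0n R k; lra.
  have : `|M| * 6 < k%:R + 1 by rewrite natr1; exact: truncnS_gt.
  have := ler_norm M; lra.
exists k; apply: (lt_le_trans Mk).
have := hump k; rewrite -{1}(subrK x (u k.+1)) rdotDl => huk.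
have := le_trans huk (ler_normD _ _).
have := ler_rdot (u k.+1 - x) (g k).
have : rnorm (u k.+1 - x) * rnorm (g k) <= (4 / 3) ^+ k / 2.
  rewrite g4 -rnormN opprB.
  apply: (@le_trans _ _ (3 / 2 * 3 ^- k.+1 * 4 ^+ k)).
    by rewrite ler_wpM2r ?exprn_ge0// ux.
  rewrite exprS invfM exprMn exprVn.
  by move: (3 ^- k) => p; rewrite le_eqVlt; apply/orP; left; apply/eqP; field.
lra.
Qed.

End real_dot.

(** * The real part of the inner product of square-integrable functions *)

Section L2_pairing.
Context (R : realType) d (T : measurableType d) (mu : {measure set T -> \bar R}).
Implicit Types (phi psi : T -> R[i]) (r t : R) (c : R[i]).

Local Notation sqi := (square_integrable mu).

Lemma sqi_scaleD c phi psi : sqi phi -> sqi psi -> sqi (c *: phi + psi).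
Proof.
move=> /asboolP phi2 /asboolP psi2; apply/asboolP.
by have [_ ZD] := L2pred_submod_closed mu; exact: ZD.
Qed.

Lemma sqi0 : sqi 0.
Proof. by apply/asboolP; have [] := L2pred_submod_closed mu. Qed.

Lemma sqiZ c phi : sqi phi -> sqi (c *: phi).
Proof. by move=> phi2; rewrite -[_ *: _]addr0; apply: sqi_scaleD => //; exact: sqi0. Qed.

Lemma sqiD phi psi : sqi phi -> sqi psi -> sqi (phi + psi).
Proof. by move=> phi2 psi2; rewrite -[phi]scale1r; exact: sqi_scaleD. Qed.

Lemma normc_sqr_integrable phi : sqi phi ->
  mu.-integrable [set: T] (fun w => (normc (phi w) ^+ 2)%:E).
Proof.
move=> [mphi phi2]; apply/integrableP; split.
  by apply/measurable_EFinP; exact: measurable_sqr_normc.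
rewrite (_ : (\int[mu]_w _)%E = (\int[mu]_w ((normc (phi w) ^+ 2)%:E))%E)//.
by apply: eq_integral => w _; rewrite gee0_abs// lee_fin sqr_ge0.
Qed.

(** The real part of phi times the conjugate of psi. *)
Definition rpair phi psi (w : T) : R :=
  complex.Re (phi w) * complex.Re (psi w) + complex.Im (phi w) * complex.Im (psi w).

Lemma measurable_rpair phi psi : cmeasurable_fun phi -> cmeasurable_fun psi ->
  measurable_fun [set: T] (rpair phi psi).
Proof.
by move=> [? ?] [? ?]; apply: measurable_funD; apply: measurable_funM.
Qed.

Lemma rpair_integrable phi psi : sqi phi -> sqi psi ->
  mu.-integrable [set: T] (EFin \o rpair phi psi).
Proof.
move=> phi2 psi2.
have := integrableD measurableT (normc_sqr_integrable phi2) (normc_sqr_integrable psi2).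
apply: le_integrable => //.
  by apply/measurable_EFinP; apply: measurable_rpair; [case: phi2 | case: psi2].
move=> w _ /=; rewrite lee_fin !Defs.sqr_normc.
rewrite [leRHS]ger0_norm ?addr_ge0 ?sqr_ge0// /rpair ler_norml.
move: (complex.Re _) (complex.Im _) (complex.Re _) (complex.Im _) => x y p q.
have := sqr_ge0 (x + p); have := sqr_ge0 (x - p).
have := sqr_ge0 (y + q); have := sqr_ge0 (y - q).
have := sqr_ge0 x; have := sqr_ge0 y; have := sqr_ge0 p; have := sqr_ge0 q.
by move=> *; apply/andP; split; nra.
Qed.

(** Defined on functions rather than on classes, so that it makes sense
    against functions which are not known to be square integrable. *)
Definition ip2 phi psi : R := \int[mu]_w rpair phi psi w.

Lemma ip2C phi psi : ip2 phi psi = ip2 psi phi.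
Proof. by apply: eq_Rintegral => w _; rewrite /rpair mulrC [X in _ + X]mulrC. Qed.

Lemma ip2Dl phi phi' psi : sqi phi -> sqi phi' -> sqi psi ->
  ip2 (phi + phi') psi = ip2 phi psi + ip2 phi' psi.
Proof.
move=> phi2 phi'2 psi2; rewrite -RintegralD//; try exact: rpair_integrable.
apply: eq_Rintegral => w _; rewrite /rpair -[(phi + phi') w]/(phi w + phi' w).
by rewrite !raddfD /=; ring.
Qed.

Lemma ip2Zl r phi psi : sqi phi -> sqi psi -> ip2 (r%:C *: phi) psi = r * ip2 phi psi.
Proof.
move=> phi2 psi2; rewrite -RintegralZl//; try exact: rpair_integrable.
apply: eq_Rintegral => w _; rewrite /rpair -[(r%:C *: phi) w]/(r%:C * phi w).
by case: (phi w) => x y /=; ring.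
Qed.

Lemma ip2Z_adj c phi psi : ip2 (c *: phi) psi = ip2 phi (Num.conj c *: psi).
Proof.
apply: eq_Rintegral => w _; rewrite /rpair.
rewrite -[(c *: phi) w]/(c * phi w) -[(Num.conj c *: psi) w]/(Num.conj c * psi w).
by case: c => p q; case: (phi w) => x y; case: (psi w) => x' y' /=; ring.
Qed.

Lemma ip2_ge0 phi : 0 <= ip2 phi phi.
Proof. by apply: Rintegral_ge0 => w _; rewrite addr_ge0// -expr2 sqr_ge0. Qed.

Lemma rpair_diag phi w : rpair phi phi w = normc (phi w) ^+ 2.
Proof. by rewrite Defs.sqr_normc. Qed.

Lemma integral_normc_sqr phi : sqi phi ->
  (\int[mu]_w (normc (phi w) ^+ 2)%:E = (ip2 phi phi)%:E)%E.
Proof.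
move=> /normc_sqr_integrable phi2.
rewrite /ip2 (@eq_Rintegral _ _ _ _ _ (fun w => normc (phi w) ^+ 2)).
  by rewrite fineK//; exact: integrable_fin_num.
by move=> w _; exact: rpair_diag.
Qed.

(** The integrand of the difference is a square: this is the positivity of
    [ip2] at t phi - psi. *)
Lemma ip2_young t phi psi : 0 < t -> sqi phi -> sqi psi ->
  2 * ip2 phi psi <= t * ip2 phi phi + t^-1 * ip2 psi psi.
Proof.
move=> t0 phi2 psi2.
have tphi2 := sqiZ t%:C phi2; have psiN2 := sqiZ (-1)%:C psi2.
have := ip2_ge0 (t%:C *: phi + (-1)%:C *: psi).
rewrite (ip2Dl tphi2 psiN2 (sqiD tphi2 psiN2)) !(ip2C _ (_ + _)).
rewrite !ip2Dl// !ip2Zl// !(ip2C _ (_ *: _)) !ip2Zl// (ip2C psi phi) => h.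
rewrite -(ler_pM2l t0) mulrDr (mulrA t t^-1) (divff (lt0r_neq0 t0)); nra.
Qed.

Lemma ip2_ae phi phi' psi : cmeasurable_fun phi -> cmeasurable_fun phi' ->
  cmeasurable_fun psi -> (\forall w \ae mu, phi w = phi' w) ->
  ip2 phi psi = ip2 phi' psi.
Proof.
move=> mphi mphi' mpsi ae; congr fine; apply: ae_eq_integral => //.
- by apply/measurable_EFinP; exact: measurable_rpair.
- by apply/measurable_EFinP; exact: measurable_rpair.
by move: ae; apply: filterS => w /= e _; rewrite /rpair e.
Qed.

Lemma cintegrable_mul_conj phi psi : sqi phi -> sqi psi ->
  cintegrable mu (fun w => phi w * Num.conj (psi w)).
Proof.
move=> phi2 psi2; split.
- rewrite (_ : (fun _ => _) = EFin \o rpair phi psi); first exact: rpair_integrable.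
  apply/funext => w; rewrite /= /rpair.
  by case: (phi w) (psi w) => x y [p q] /=; congr EFin; ring.
- rewrite (_ : (fun _ => _) = EFin \o rpair phi ((0 +i* 1) *: psi)).
    by apply: rpair_integrable => //; exact: sqiZ.
  apply/funext => w; rewrite /= /rpair -[((0 +i* 1) *: psi) w]/((0 +i* 1) * psi w).
  by case: (phi w) (psi w) => x y [p q] /=; congr EFin; ring.
Qed.

(** As for [Im_dot], the imaginary part is the real pairing with i psi. *)
Lemma cintegral_mul_conj phi psi :
  cintegral mu (fun w => phi w * Num.conj (psi w)) =
  ip2 phi psi +i* ip2 phi ((0 +i* 1) *: psi).
Proof.
congr Complex; apply: eq_Rintegral => w _; rewrite /rpair.
  by case: (phi w) (psi w) => x y [p q] /=; ring.
rewrite -[((0 +i* 1) *: psi) w]/((0 +i* 1) * psi w).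
by case: (phi w) (psi w) => x y [p q] /=; ring.
Qed.

Lemma fatou_bound (g_ : nat -> T -> R) (g : T -> R) (C : \bar R) :
  (forall k, measurable_fun [set: T] (g_ k)) -> (forall k w, 0 <= g_ k w) ->
  (forall w, g_ k w @[k --> \oo] --> g w) ->
  (forall k, (\int[mu]_w (g_ k w)%:E <= C)%E) -> (\int[mu]_w (g w)%:E <= C)%E.
Proof.
move=> mg g0 gg gC.
have := @fatou _ _ _ mu _ measurableT (fun k w => (g_ k w)%:E)
  (fun k => proj2 (measurable_EFinP _ _) (mg k)) (fun k w _ => g0 k w).
rewrite (eq_integral (fun w => (g w)%:E)); last first.
  by move=> w _; have /cvg_limn_einf_sup[-> _] : (g_ k w)%:E @[k --> \oo] --> (g w)%:E
    by apply: cvg_EFin => //; [exact: nearW | exact: gg].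
move=> /le_trans; apply; apply: (le_trans (limn_einf_sup _)).
rewrite limn_esup_lim; apply: lime_le; first exact: is_cvg_esups.
by apply: nearW => k; apply: ub_ereal_sup => _ [l _ <-].
Qed.

End L2_pairing.

(** * The analysis operator and its adjoint *)

Section L2_classes.
Context (R : realType) d (T : measurableType d) (mu : {measure set T -> \bar R}).

Lemma L2fun_sqi (phi : L2fun mu) : square_integrable mu phi.
Proof. by case: phi => phi /= /asboolP. Qed.

Lemma L2class_ae (phi psi : L2fun mu) : L2class phi = L2class psi ->
  \forall w \ae mu, phi w = psi w.
Proof.
move=> /qproj_eq /asboolP; apply: filterS => w /= /eqP.
by rewrite -[X in X == _]/(phi w - psi w) subr_eq0 => /eqP.
Qed.

Lemma L2class_repr (u : L2 mu) : L2class (qrepr u) = u.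
Proof. exact: qreprK. Qed.

Lemma ip2_L2class (phi psi : L2fun mu) f : L2class phi = L2class psi ->
  square_integrable mu f -> ip2 mu phi f = ip2 mu psi f.
Proof.
move=> /L2class_ae e [mf _]; have [mphi _] := L2fun_sqi phi.
by have [mpsi _] := L2fun_sqi psi; exact: ip2_ae.
Qed.

Lemma L2norm_sqr (u : L2 mu) : L2norm u ^+ 2 = ip2 mu (qrepr u) (qrepr u).
Proof.
by rewrite /L2norm integral_normc_sqr ?sqr_sqrtr ?ip2_ge0//; exact: L2fun_sqi.
Qed.

End L2_classes.

Section analysis_operator.
Context (R : realType) (V : completeNormedModType R[i]).
Variable dot : {dot V for Num.conj}.
Hypothesis dot_norm : forall h, `|h| ^+ 2 = dot h h.
Context d (T : measurableType d) (mu : {measure set T -> \bar R}).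
Variable X : T -> V.
Implicit Types (f g x y : V) (c : R[i]).

Definition analysis f : T -> R[i] := fun w => dot f (X w).
Local Notation S := analysis.
Local Notation energy f := (ip2 mu (S f) (S f)).

Lemma analysisD f g : S (f + g) = S f + S g.
Proof. by apply/funext => w; exact: dotDl. Qed.

Lemma analysisZ c f : S (c *: f) = c *: S f.
Proof. by apply/funext => w; exact: dotZl. Qed.

Section extension.
Variable D : set V.
Hypothesis D_dense : dense D.

(** The bound by [e] on all terms lets the norms of the approximating vectors
    be controlled while they converge weakly. *)
Lemma dense_rdot_cvg (e : R) f : 0 < e -> exists u : nat -> V,
  [/\ forall k, D (u k), forall k, rnorm (f - u k) <= e
    & forall z, rdot dot (u k) z @[k --> \oo] --> rdot dot f z].
Proof.
move=> e0.
have [u uP] : {u : nat -> V & forall k, D (u k) /\ rnorm (f - u k) < Num.min e k.+1%:R^-1}.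
  apply: (@choice _ _ (fun k x => D x /\ rnorm (f - x) < Num.min e k.+1%:R^-1)) => k.
  have [|x Dx xf] := rnorm_dense D_dense f (_ : 0 < Num.min e k.+1%:R^-1).
    by rewrite lt_min e0 invr_gt0 ltr0n.
  by exists x.
exists u; split=> [k|k|z]; first by have [] := uP k.
  by have [_ /ltW] := uP k; rewrite le_min => /andP[].
apply/cvgrPdist_lt => r r0.
exists (Num.truncn ((rnorm z + 1) / r)) => // k /= Nk.
rewrite -rdotNl -rdotDl (le_lt_trans (ler_rdot dot_norm _ _))//.
have [_] := uP k; rewrite lt_min => /andP[_ uk].
have z1 : 0 < rnorm z + 1 by rewrite ltr_wpDl ?rnorm_ge0.
have : (rnorm z + 1) / r < k.+1%:R.
  by rewrite (lt_le_trans (truncnS_gt _))// ler_nat ltnS.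
rewrite ltr_pdivrMr// => zr.
apply: (@le_lt_trans _ _ (k.+1%:R^-1 * rnorm z)).
  by rewrite ler_wpM2r ?rnorm_ge0// ltW.
by rewrite mulrC ltr_pdivrMr ?ltr0n//; nra.
Qed.

Hypothesis S_meas : forall f, D f -> cmeasurable_fun (S f).

(** A pointwise limit of measurable functions, as w is fixed in
    <f, X w> while f is approximated in D. *)
Lemma analysis_measurable f : cmeasurable_fun (S f).
Proof.
have [u [Du _ uf]] := dense_rdot_cvg f ltr01.
split.
- by apply: (measurable_fun_cvg (fun k => proj1 (S_meas (Du k)))) => w _; exact: uf.
- apply: (measurable_fun_cvg (fun k => proj2 (S_meas (Du k)))) => w _.
  rewrite [X in _ --> X](Im_dot dot).
  under eq_cvg do rewrite (Im_dot dot).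
  exact: uf.
Qed.

(** Approximating f by vectors of D of norm at most 2 |f|, hence the factor 4,
    Fatou's lemma bounds the energy of the pointwise limit S f. *)
Lemma analysis_bound (B : R) : 0 <= B ->
  (forall f, D f -> (\int[mu]_w (normc (S f w) ^+ 2)%:E <= (B * rnorm f ^+ 2)%:E)%E) ->
  forall f, square_integrable mu (S f) /\ energy f <= 4 * B * rnorm f ^+ 2.
Proof.
move=> B0 SB f.
have [->|f0] := eqVneq f 0.
  have -> : S 0 = (0 : T -> R[i]) by apply/funext => w; exact: linear0l.
  split; first exact: sqi0.
  suff e0 : ip2 mu (0 : T -> R[i]) 0 = 0 by rewrite e0 mulr_ge0 ?sqr_ge0// mulr_ge0.
  by rewrite -{1}[0](scale0r (0 : T -> R[i])) ip2Zl ?mul0r//; exact: sqi0.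
have f1 : 0 < rnorm f by rewrite rnorm_gt0.
have Sf : (\int[mu]_w (normc (S f w) ^+ 2)%:E <= (4 * B * rnorm f ^+ 2)%:E)%E.
  have [u [Du fu uf]] := dense_rdot_cvg f f1.
  apply: (@fatou_bound _ _ _ _ (fun k w => normc (S (u k) w) ^+ 2)).
  - by move=> k; apply: measurable_sqr_normc; exact: S_meas.
  - by move=> k w; exact: sqr_ge0.
  - move=> w; rewrite Defs.sqr_normc.
    under eq_cvg do rewrite Defs.sqr_normc.
    apply: cvgD; rewrite expr2; under eq_cvg do rewrite expr2; apply: cvgM.
    + exact: uf.
    + exact: uf.
    + by rewrite (Im_dot dot); under eq_cvg do rewrite (Im_dot dot); exact: uf.
    + by rewrite (Im_dot dot); under eq_cvg do rewrite (Im_dot dot); exact: uf.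
  move=> k; apply: (le_trans (SB _ (Du k))); rewrite lee_fin.
  rewrite (mulrC 4) -mulrA ler_wpM2l// (_ : 4 * _ = (rnorm f + rnorm f) ^+ 2); last by ring.
  rewrite lerXn2r ?nnegrE ?addr_ge0 ?rnorm_ge0//.
  by rewrite -[u k](subKr f) (le_trans (rnorm_triangle _ _))// rnormN lerD.
have Sf2 : square_integrable mu (S f).
  by split; [exact: analysis_measurable | exact: le_lt_trans Sf (ltry _)].
by split=> //; move: Sf; rewrite integral_normc_sqr.
Qed.

(** Replace f by some g in D with |f - g| <= s |f|.  Both |.|^2 and the energy
    satisfy N (x + y) <= 2 N x + 2 N y, which gives
    A |f|^2 <= 2 A |g|^2 + 2 A |f - g|^2 <= 4 energy f + 4 (A + B) |f - g|^2,
    and s is chosen so that the last term is at most a quarter of A |f|^2. *)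
Lemma analysis_coercive (A B : R) : 0 < A -> 0 <= B ->
  (forall f, square_integrable mu (S f)) ->
  (forall f, energy f <= B * rnorm f ^+ 2) ->
  (forall f, D f -> A * rnorm f ^+ 2 <= energy f) ->
  exists2 A', 0 < A' & forall f, A' * rnorm f ^+ 2 <= energy f.
Proof.
move=> A0 B0 S2 SB SA; exists (A / 8); first by rewrite divr_gt0.
move=> f; have [->|f0] := eqVneq f 0.
  by rewrite {1}/rnorm normr0 expr0n mulr0 ip2_ge0.
have f1 : 0 < rnorm f by rewrite rnorm_gt0.
have AB : 0 < A + B by rewrite ltr_wpDr.
have [s s0 s2] : exists2 s, 0 < s & s ^+ 2 * (16 * (A + B)) = A.
  exists (Num.sqrt (A / (16 * (A + B)))); first by rewrite sqrtr_gt0 divr_gt0 ?mulr_gt0.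
  by rewrite sqr_sqrtr ?divfK ?gt_eqF ?divr_ge0 ?mulr_ge0 ?mulr_gt0 ?ltW.
have [|g Dg fg] := rnorm_dense D_dense f (_ : 0 < s * rnorm f).
  by rewrite mulr_gt0.
have fg2 : rnorm (f - g) ^+ 2 <= s ^+ 2 * rnorm f ^+ 2.
  by rewrite -exprMn lerXn2r ?nnegrE ?rnorm_ge0 ?mulr_ge0 ?rnorm_ge0 ?ltW.
have par x y : rnorm (x + y) ^+ 2 <= 2 * rnorm x ^+ 2 + 2 * rnorm y ^+ 2.
  have := sqr_ge0 (rnorm (x - y)).
  rewrite -!(rdotxx dot_norm) !(rdotDl, rdotDr, rdotNl, rdotNr) (rdotC _ y x); lra.
have Epar x y : energy (x + y) <= 2 * energy x + 2 * energy y.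
  have := ip2_young ltr01 (S2 x) (S2 y).
  rewrite !analysisD invr1 !mul1r (ip2Dl (S2 x) (S2 y) (sqiD (S2 x) (S2 y))).
  by rewrite !(ip2C _ _ (_ + _)) !ip2Dl// (ip2C _ (S y)); lra.
have hg := SA _ Dg.
have := ler_wpM2l (ltW A0) (par g (f - g)); have := Epar f (g - f); have := SB (g - f).
rewrite !(addrC _ (_ - _)) !subrK -(rnormN (g - f)) opprB.
have : A * rnorm (f - g) ^+ 2 <= A * (s ^+ 2 * rnorm f ^+ 2) by rewrite ler_wpM2l // ltW.
have : B * rnorm (f - g) ^+ 2 <= B * (s ^+ 2 * rnorm f ^+ 2) by rewrite ler_wpM2l.
have : s ^+ 2 * rnorm f ^+ 2 * (A + B) = A / 16 * rnorm f ^+ 2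
  by have -> : A / 16 = s ^+ 2 * (A + B); [lra | ring].
move: (energy f) (energy g) (energy (g - f)) hg => e1 e2 e3 hg.
have : 0 <= A * rnorm f ^+ 2 by rewrite mulr_ge0 ?sqr_ge0 ?ltW.
have : 0 <= A * rnorm (f - g) ^+ 2 by rewrite mulr_ge0 ?sqr_ge0 ?ltW.
move: (rnorm f ^+ 2) (s ^+ 2) => p q.
lra.
Qed.

End extension.

Section synthesis.
Variables (B : R).
Hypotheses (B_gt0 : 0 < B) (S2 : forall f, square_integrable mu (S f))
  (SB : forall f, energy f <= B * rnorm f ^+ 2).

Let LD phi : square_integrable mu phi -> forall f g,
  ip2 mu phi (S (f + g)) = ip2 mu phi (S f) + ip2 mu phi (S g).
Proof. by move=> phi2 f g; rewrite analysisD !(ip2C _ phi) ip2Dl. Qed.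

Let LZ phi : square_integrable mu phi -> forall (r : R) f,
  ip2 mu phi (S (r%:C *: f)) = r * ip2 mu phi (S f).
Proof. by move=> phi2 r f; rewrite analysisZ !(ip2C _ phi) ip2Zl. Qed.

(** The Riesz representation of f |-> <phi, S f>: [lax_milgram] for the inner
    product itself. *)
Lemma riesz_synthesis phi : square_integrable mu phi ->
  exists x, forall f, rdot dot x f = ip2 mu phi (S f).
Proof.
move=> phi2; apply: (@lax_milgram _ _ _ 1 1 _ (B * ip2 mu phi phi)) => //.
- exact: rdotC.
- exact: rdotDl.
- exact: rdotZl.
- by move=> x; rewrite rdotxx// mul1r.
- by move=> x; rewrite rdotxx// mul1r.
- exact: LD.
- exact: LZ.
move=> f; apply: (le_trans (ip2_young B_gt0 phi2 (S2 f))).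
by rewrite addrC lerD2r rdotxx// ler_pdivrMl.
Qed.

(** Linearity holds because a vector is determined by its real products.  For
    the bound, take f = TC u in <TC u, f> = <u, S f>: Young's inequality with
    parameter B gives 2 |TC u|^2 <= B |u|^2 + |TC u|^2. *)
Lemma synthesis_exists : exists TC : {linear L2 mu -> V},
  (forall (phi : L2fun mu) f, rdot dot (TC (L2class phi)) f = ip2 mu phi (S f))
  /\ bounded_operator TC.
Proof.
have TC_ex (u : L2 mu) : exists x, forall f, rdot dot x f = ip2 mu (qrepr u) (S f).
  by apply: riesz_synthesis; exact: L2fun_sqi.
have [TC TCE] := choice TC_ex.
have TC_linear : linear TC.
  move=> c u v; apply: (rdot_inj dot_norm) => f.
  rewrite rdotDl rdotZ_adj !TCE analysisZ -ip2Z_adj.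
  rewrite -ip2Dl ?S2//; [|exact: sqiZ (L2fun_sqi _)|exact: L2fun_sqi].
  apply: (@ip2_L2class _ _ _ _ _ (c *: qrepr u + qrepr v)); last exact: S2.
  by rewrite /L2class linearP /= !qreprK.
pose TCl := HB.pack TC (GRing.isLinear.Build _ _ _ _ TC TC_linear) : {linear L2 mu -> V}.
exists TCl; split=> [phi f|].
  by rewrite TCE; apply: ip2_L2class => //; exact: L2class_repr.
exists (Num.sqrt B) => u; rewrite rnormE lecR -[TCl u]/(TC u).
rewrite -(@ler_pXn2r _ 2) ?nnegrE ?rnorm_ge0 ?mulr_ge0 ?sqrtr_ge0//.
rewrite exprMn (sqr_sqrtr (ltW B_gt0)) L2norm_sqr.
have := ip2_young B_gt0 (L2fun_sqi (qrepr u)) (S2 (TC u)).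
have : B^-1 * energy (TC u) <= rnorm (TC u) ^+ 2 by rewrite ler_pdivrMl.
by rewrite -TCE rdotxx//; lra.
Qed.

(** The frame form <S x, S g> is coercive, so [lax_milgram] represents
    g |-> <h, g> by some x, and S x is a preimage of h. *)
Lemma synthesis_onto (A : R) : 0 < A -> (forall f, A * rnorm f ^+ 2 <= energy f) ->
  forall TC : L2 mu -> V,
  (forall (phi : L2fun mu) f, rdot dot (TC (L2class phi)) f = ip2 mu phi (S f)) ->
  forall h, exists u, TC u = h.
Proof.
move=> A0 SA TC TCE h.
have [x xh] : exists x, forall g, ip2 mu (S x) (S g) = rdot dot h g.
  apply: (@lax_milgram _ _ _ A B _ (A^-1 * rnorm h ^+ 2)) => //.
  - by move=> x y; exact: ip2C.
  - by move=> x y z; rewrite analysisD ip2Dl.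
  - by move=> r x y; rewrite analysisZ ip2Zl.
  - by move=> x y; exact: rdotDr.
  - by move=> r x; exact: rdotZr.
  move=> x; apply: le_trans (lerD (SA x) (lexx _)).
  rewrite -(ler_pM2l A0) mulrDr mulVKf ?gt_eqF//.
  have := sqr_ge0 (rnorm (A%:C *: x - h)).
  rewrite -!(rdotxx dot_norm) !(rdotDl, rdotDr, rdotNl, rdotNr, rdotZl, rdotZr).
  by rewrite (rdotC _ x h); nra.
have Sx : S x \in L2pred mu by apply/asboolP; exact: S2.
exists (L2class (MkL2fun Sx)); apply: (rdot_inj dot_norm) => g.
by rewrite TCE xh.
Qed.

End synthesis.

End analysis_operator.

(** * Frame bounds from a bounded onto synthesis operator *)

Section truncation.
Context (R : realType) d (T : measurableType d).
Variable mu : {sigma_finite_measure set T -> \bar R}.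

(** E k is the intersection of a finite union of sets of finite measure with
    the set where |psi|^2 is at most k; sigma-finiteness makes these sets exhaust the
    space. *)
Lemma sqi_exhaustion (psi : T -> R[i]) : cmeasurable_fun psi ->
  exists E : nat -> set T,
    [/\ forall k, measurable (E k),
        forall w, \forall k \near \oo, E k w
      & forall k, square_integrable mu (fun w => (\1_(E k) w)%:C * psi w)].
Proof.
move=> mpsi.
have [G GT Gfin] := sigma_finiteT mu.
pose N k := [set w | normc (psi w) ^+ 2 <= k%:R].
pose E k := (\big[setU/set0]_(i < k) G i) `&` N k.
have mN k : measurable (N k).
  rewrite -[N k]setTI; apply: measurable_fun_le => //; exact: measurable_sqr_normc.
have mU k : measurable (\big[setU/set0]_(i < k) G i).
  by apply: bigsetU_measurable => i _; have [] := Gfin i.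
have mE k : measurable (E k) by exact: measurableI.
have muE k : (mu (E k) < +oo)%E.
  apply: (@le_lt_trans _ _ (mu (\big[setU/set0]_(i < k) G i))).
    by apply: le_measure; rewrite ?inE//; exact: subIsetl.
  apply: (@le_lt_trans _ _ (\sum_(i < k) mu (G i))%E).
    by apply: (@Boole_inequality _ _ _ mu G) => i; have [] := Gfin i.
  by apply/lte_sum_pinfty => i _; have [] := Gfin i.
exists E; split=> // [w|k].
  have [i _ Gi] : (\bigcup_i G i) w by rewrite -GT.
  exists (maxn i.+1 (Num.truncn (normc (psi w) ^+ 2)).+1) => // k /=.
  rewrite geq_max => /andP[ik nk]; split.
    by rewrite -bigcup_mkord; exists i.
  by rewrite /N /= (le_trans (ltW (truncnS_gt _)))// ler_nat.
have mphi : cmeasurable_fun (fun w => (\1_(E k) w)%:C * psi w).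
  have [mr mi] := mpsi; split.
    rewrite (_ : (fun _ => _) = fun w => \1_(E k) w * complex.Re (psi w)).
      exact: measurable_funM.
    by apply/funext => w; case: (psi w) => x y /=; rewrite mul0r subr0.
  rewrite (_ : (fun _ => _) = fun w => \1_(E k) w * complex.Im (psi w)).
    exact: measurable_funM.
  by apply/funext => w; case: (psi w) => x y /=; rewrite mul0r addr0.
split=> //.
apply: (@le_lt_trans _ _ (\int[mu]_w (k%:R%:E * (\1_(E k) w)%:E))%E).
  apply: ge0_le_integral => //=.
  - by move=> w _; rewrite lee_fin sqr_ge0.
  - by apply/measurable_EFinP; exact: measurable_sqr_normc.
  - by apply/measurable_EFinP; apply: measurable_funM.
  move=> w _; rewrite -EFinM lee_fin indicE.
  case: (boolP (w \in E k)) => [|_].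
    by rewrite inE => -[_ Nw]; rewrite mul1r mulr1.
  by rewrite mul0r mulr0 normc0 expr0n.
rewrite ge0_integralZl//; last by apply/measurable_EFinP.
by rewrite integral_indic// setIT lte_mul_pinfty//; exact: muE.
Qed.

End truncation.

Section frame_from_synthesis.
Context (R : realType) (V : completeNormedModType R[i]).
Variable dot : {dot V for Num.conj}.
Hypothesis dot_norm : forall h, `|h| ^+ 2 = dot h h.
Context d (T : measurableType d).
Variable mu : {sigma_finite_measure set T -> \bar R}.
Variables (X : T -> V) (TC : L2 mu -> V) (D : set V).
Local Notation S := (analysis dot X).
Local Notation energy f := (ip2 mu (S f) (S f)).
Hypothesis TCE : forall (phi : L2fun mu) f,
  rdot dot (TC (L2class phi)) f = ip2 mu phi (S f).

(** With phi = S f 1_E, the squared norm l^2 of phi equals <TC phi, f>, hence is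
    at most M l |f|, and l <= M |f|.  Fatou's lemma lets E grow to the whole space. *)
Lemma bounded_synthesis_bessel (M : R) : 0 <= M ->
  (forall u, rnorm (TC u) <= M * L2norm u) ->
  forall f, cmeasurable_fun (S f) ->
  (\int[mu]_w (normc (S f w) ^+ 2)%:E <= (M ^+ 2 * rnorm f ^+ 2)%:E)%E.
Proof.
move=> M0 TCM f mSf; have [E [mE Ew E2]] := sqi_exhaustion mu mSf.
pose phi k w := (\1_(E k) w)%:C * S f w.
have pair_phi k : ip2 mu (phi k) (S f) = ip2 mu (phi k) (phi k).
  apply: eq_Rintegral => w _; rewrite /rpair /phi indicE.
  by case: (w \in E k); rewrite ?mul1r// mul0r !mul0r.
apply: (@fatou_bound _ _ _ _ (fun k w => normc (phi k w) ^+ 2)).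
- by move=> k; apply: measurable_sqr_normc; have [] := E2 k.
- by move=> k w; exact: sqr_ge0.
- move=> w; apply: cvg_near_cst; have := Ew w; apply: filterS => k Ek.
  by rewrite /phi indicE mem_set ?mul1r.
move=> k; rewrite integral_normc_sqr; last exact: E2.
have phiL2 : phi k \in L2pred mu by apply/asboolP; exact: E2.
pose u : L2fun mu := MkL2fun phiL2.
rewrite lee_fin -exprMn -pair_phi -[phi k]/(L2val u) -TCE.
have := rdot_le dot_norm (TC (L2class u)) f; have := TCM (L2class u).
have : L2norm (L2class u) ^+ 2 = rdot dot (TC (L2class u)) f.
  rewrite TCE pair_phi L2norm_sqr.
  rewrite (ip2_L2class (L2class_repr _)); last exact: L2fun_sqi.
  rewrite ip2C (ip2_L2class (L2class_repr _))//; exact: L2fun_sqi.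
have := sqrtr_ge0 (fine (\int[mu]_w ((normc (qrepr (L2class u) w) ^+ 2)%:E))%E).
rewrite -/(L2norm (L2class u)); have := rnorm_ge0 f.
move: (rdot _ _ _) (rnorm (TC _)) (L2norm _) (rnorm f) => r t l n n0 l0 <- tl lt.
have ll : l * l <= (M * n) * l.
  by rewrite -expr2 (le_trans lt)// mulrAC ler_wpM2r.
rewrite lerXn2r ?nnegrE ?mulr_ge0//; move: l0; rewrite le_eqVlt => /predU1P[<-|l0].
  by rewrite mulr_ge0.
by rewrite -(ler_pM2r l0).
Qed.

(** Without a lower bound some f_k satisfies energy f_k < 16^-k |f_k|^2.
    Rescaled to norm 4^k it has energy below 1, so its product with any TC u is at
    most (|u|^2 + 1) / 2, contradicting [gliding_hump] when TC is onto. *)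
Lemma onto_synthesis_coercive : (forall h, exists u, TC u = h) ->
  (forall f, D f -> square_integrable mu (S f)) ->
  exists2 A : R, 0 < A & forall f, D f -> A * rnorm f ^+ 2 <= energy f.
Proof.
move=> onto S2; apply: contrapT => noA.
have bad k : exists f, D f /\ energy f < 16 ^- k * rnorm f ^+ 2.
  apply: contrapT => nof; apply: noA; exists (16 ^- k).
    by rewrite invr_gt0 exprn_gt0.
  move=> f Df; rewrite leNgt; apply/negP => fbad.
  by apply: nof; exists f.
have [f fP] := choice bad.
have f_gt0 k : 0 < rnorm (f k).
  rewrite lt_def rnorm_ge0 andbT; apply/negP => /eqP f0.
  have [_] := fP k; rewrite f0 expr0n mulr0 ltNge; move/negP; apply.
  exact: ip2_ge0.
pose c k : R := 4 ^+ k / rnorm (f k).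
pose g k := (c k)%:C *: f k.
have [k|h hP] := @gliding_hump _ _ _ dot_norm g.
  rewrite rnormZ ger0_norm ?divr_ge0 ?exprn_ge0 ?rnorm_ge0//.
  by rewrite divfK// gt_eqF.
have [u uh] := onto h.
have [k] := hP ((ip2 mu (qrepr u) (qrepr u) + 1) / 2).
have [Df fbad] := fP k; have Sf2 := S2 _ Df.
have Sg2 : square_integrable mu (S (g k)) by rewrite analysisZ; exact: sqiZ.
have g1 : energy (g k) < 1.
  rewrite analysisZ ip2Zl ?(ip2C _ (S (f k))) ?ip2Zl//; last exact: sqiZ.
  have c0 : 0 < c k * c k by rewrite mulr_gt0 ?divr_gt0 ?exprn_gt0.
  rewrite mulrA -(ltr_pM2l c0) in fbad *.
  apply: (lt_le_trans fbad); rewrite le_eqVlt; apply/orP; left; apply/eqP.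
  rewrite /c (_ : 16 = 4 * 4 :> R) ?exprMn; last by ring.
  by field; rewrite expf_neq0//; exact: (lt0r_neq0 (f_gt0 k)).
have -> : rdot dot h (g k) = ip2 mu (qrepr u) (S (g k)).
  by rewrite -TCE L2class_repr uh.
rewrite ltNge => /negP; apply.
have u2 := L2fun_sqi (qrepr u).
have := ip2_young ltr01 u2 Sg2.
have := ip2_young ltr01 (sqiZ (-1)%:C u2) Sg2.
rewrite !ip2Zl ?(ip2C _ _ (_ *: _)) ?ip2Zl//; last exact: sqiZ.
rewrite invr1 !mul1r ler_norml => h1 h2; apply/andP; split; lra.
Qed.

End frame_from_synthesis.

(** * The embedding of an n-Hilbert space in its completion *)

Section embedding.
Context (R : realType) (n : nat) (H1 : lmodType R[i]).
Variables (ip : H1 -> H1 -> n.-1.-tuple H1 -> R[i]) (a : n.-1.-tuple H1).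
Hypothesis ip_n : n_inner_product ip.
Context (HF : completeNormedModType R[i]) (dotF : {dot HF for Num.conj}).
Variable j : {linear quotF a -> HF}.
Hypothesis HF_completion : hilbert_completion ip dotF j.

Lemma dot_embF x y : dotF (embF j x) (embF j y) = ip x y a.
Proof. by rewrite (hc_isom HF_completion) (ipFE a ip_n). Qed.

Lemma range_embF h : range j h -> exists x, embF j x = h.
Proof. by move=> [u _ <-]; exists (qrepr u); rewrite /embF qreprK. Qed.

Lemma rnorm_embF x : rnorm (embF j x) = nnorm ip x a.
Proof.
rewrite /nnorm -dot_embF -[complex.Re _]/(rdot dotF _ _).
by rewrite (rdotxx (hc_norm HF_completion)) sqrtr_sqr ger0_norm ?rnorm_ge0.
Qed.

Section frame.
Context d (Om : measurableType d) (F : Om -> H1).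

Lemma analysis_embF x w : analysis dotF (embF j \o F) (embF j x) w = ip x (F w) a.
Proof. exact: dot_embF. Qed.

Lemma integrand_synthesis (phi : Om -> R[i]) f :
  (fun w => phi w * dotF (embF j (F w)) f) =
  (fun w => phi w * Num.conj (analysis dotF (embF j \o F) f w)).
Proof. by apply/funext => w; rewrite (dotC dotF). Qed.

Lemma preframe_operatorP (mu : {measure set Om -> \bar R}) (TC : L2 mu -> HF) :
  (forall f, square_integrable mu (analysis dotF (embF j \o F) f)) ->
  (forall (phi : L2fun mu) f,
     rdot dotF (TC (L2class phi)) f = ip2 mu phi (analysis dotF (embF j \o F) f)) ->
  preframe_operator F dotF j TC.
Proof.
move=> S2 TCE phi f; rewrite integrand_synthesis; split.
  by apply: cintegrable_mul_conj; [exact: L2fun_sqi | exact: S2].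
rewrite cintegral_mul_conj -analysisZ -!TCE -Im_dot /rdot.
by case: (dotF _ _).
Qed.

Lemma preframe_operator_rdot (mu : {measure set Om -> \bar R}) (TC : L2 mu -> HF) :
  preframe_operator F dotF j TC -> forall (phi : L2fun mu) f,
  rdot dotF (TC (L2class phi)) f = ip2 mu phi (analysis dotF (embF j \o F) f).
Proof.
move=> TCP phi f; have [_] := TCP phi f.
by rewrite /rdot => ->; rewrite integrand_synthesis cintegral_mul_conj.
Qed.

End frame.
End embedding.

Theorem theorem3p9 (R : realType) (n : nat) (n_ge2 : (2 <= n)%N)
  (H1 : lmodType R[i]) (ip : H1 -> H1 -> n.-1.-tuple H1 -> R[i])
  (H1_hilbert : n_hilbert ip)
  (a : n.-1.-tuple H1) (a_indep : lin_indep a)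
  (HF : completeNormedModType R[i]) (dotF : {dot HF for Num.conj})
  (j : {linear quotF a -> HF}) (HF_completion : hilbert_completion ip dotF j)
  (d : measure_display) (Om : measurableType d)
  (mu : {sigma_finite_measure set Om -> \bar R})
  (F : Om -> H1) (F_meas : weakly_measurable ip a F) :
  continuous_frame ip a mu F <->
  exists TC : {linear L2 mu -> HF},
    [/\ preframe_operator F dotF j TC,
        bounded_operator TC
      & forall h : HF, exists u : L2 mu, TC u = h].
Proof.
have [ip_n _] := H1_hilbert.
have dot_norm := hc_norm HF_completion.
have j_dense := hc_dense HF_completion.
pose S := analysis dotF (embF j \o F).
have SE x : S (embF j x) = fun w => ip x (F w) a.
  by apply/funext => w; exact: analysis_embF.
have S_meas f : range j f -> cmeasurable_fun (S f).
  by move=> /range_embF[x <-]; rewrite SE; exact: F_meas.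
split=> [[_ [A [B [A0 AB frame]]]]|[TC [TCP [M TCM] onto]]].
  have B0 : 0 < B := lt_le_trans A0 AB.
  have S2B f : square_integrable mu (S f) /\
      ip2 mu (S f) (S f) <= 4 * B * rnorm f ^+ 2.
    apply: (analysis_bound dot_norm j_dense S_meas (ltW B0)) => {}f /range_embF[x <-].
    by have /andP[_] := frame x; rewrite -/(S _) SE (rnorm_embF ip_n HF_completion).
  have S2 f := proj1 (S2B f); have SB f := proj2 (S2B f).
  have B4 : 0 < 4 * B by rewrite mulr_gt0.
  have [|A' A'0 SA] := analysis_coercive dot_norm j_dense A0 (ltW B4) S2 SB.
    move=> f /range_embF[x <-]; rewrite -lee_fin -integral_normc_sqr//.
    by have /andP[+ _] := frame x; rewrite -/(S _) SE (rnorm_embF ip_n HF_completion).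
  have [TC [TCE TCb]] := synthesis_exists dot_norm B4 S2 SB.
  exists TC; split=> //; first exact: preframe_operatorP.
  exact: (synthesis_onto dot_norm S2 SB A'0 SA TCE).
have TCE := preframe_operator_rdot TCP.
have TCM' u : rnorm (TC u) <= `|M| * L2norm u.
  rewrite -lecR -rnormE (le_trans (TCM u))// lecR ler_wpM2r ?ler_norm//.
  exact: sqrtr_ge0.
have bessel := bounded_synthesis_bessel dot_norm TCE (normr_ge0 M) TCM'.
have S2 f : range j f -> square_integrable mu (S f).
  move=> jf; split; first exact: S_meas.
  by apply: le_lt_trans (bessel _ (S_meas _ jf)) _; exact: ltry.
have [A A0 SA] := onto_synthesis_coercive dot_norm TCE onto S2.
have jx x : range j (embF j x) by exists (qproj (LF_submod_closed a) x).
split=> //; exists A, (Num.max A (`|M| ^+ 2)); split=> // [|x].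
  by rewrite le_max lexx.
rewrite -(rnorm_embF ip_n HF_completion).
have -> : (\int[mu]_w (normc (ip x (F w) a) ^+ 2)%:E =
           \int[mu]_w (normc (S (embF j x) w) ^+ 2)%:E)%E by rewrite SE.
apply/andP; split.
  by rewrite integral_normc_sqr ?lee_fin; [exact: SA | exact: S2].
apply: (le_trans (bessel _ (S_meas _ (jx x)))).
by rewrite lee_fin ler_wpM2r ?sqr_ge0// le_max lexx orbT.
Qed.
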